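(* Let $f_1,\dots,f_n:\mathbb{R}^d\to\mathbb{R}$ be convex, let $F=\sum_{i=1}^nf_i$, and assume that the solution set $\mathcal{W}^*=\arg\min_{\mathbf{w}\in\mathbb{R}^d}F(\mathbf{w})$ is non-empty and that for each $i\in[n]$ there is a finite constant $L_i$ such that $\|\mathbf{g}\|\le L_i$ for all $\mathbf{w}\in\mathbb{R}^d$ and all $\mathbf{g}\in\partial f_i(\mathbf{w})$. Let $\mathcal{G}=([n],\mathcal{E})$ be a connected communication graph and consider the subgradient method $$W(t+1)=A(t,X(t))X(t),\qquad X(t+1)=W(t+1)-\alpha(t+1)G(t+1),\qquad t\ge0.$$ Assume that the random matrices $A(t,X(t))$ are doubly stochastic and contracting, and that the step-sizes $\alpha(t)>0$ form a non-increasing sequence with $\sum_{t=1}^\infty\alpha(t)=\infty$ and $\sum_{t=1}^\infty\alpha^2(t)<\infty$. Then for every initial condition $X(0)\in\mathbb{R}^{n\times d}$, almost surely there is a (possibly sample-path dependent) $\mathbf{w}^*\in\mathcal{W}^*$ such that $$\lim_{t\to\infty}\mathbf{w}_i(t)=\mathbf{w}^*\quad\text{for all }i\in[n].$$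
   Context: $[n]=\{1,\dots,n\}$. $X(t)\in\mathbb{R}^{n\times d}$ has $i$-th row $\mathbf{x}_i(t)^T$, $W(t)$ has $i$-th row $\mathbf{w}_i(t)^T$, and $G(t)$ has $i$-th row $\mathbf{g}_i(t)^T$, where $\mathbf{g}_i(t)\in\partial f_i(\mathbf{w}_i(t))$ is a subgradient of $f_i$ at $\mathbf{w}_i(t)$ and $\partial f_i$ is the convex subdifferential. $A(t,X(t))$ is a (possibly random) $n\times n$ averaging matrix with non-negative entries that may depend on $t$ and the state $X(t)$. $\mathcal{F}_t$ is the $\sigma$-algebra generated by $X(0),\dots,X(t)$ and $A(0,X(0)),\dots,A(t-1,X(t-1))$ (so it does not include $A(t,X(t))$). For $X=[\mathbf{x}_1,\dots,\mathbf{x}_n]^T$, $V(X)=\sum_{i=1}^n\|\mathbf{x}_i-\bar{\mathbf{x}}\|^2$ with $\bar{\mathbf{x}}=\frac1n\sum_{i=1}^n\mathbf{x}_i$. The averaging matrices $A(t,X(t))$ are called contracting (with respect to $V$) if there exists $\lambda\in(0,1)$ such that $\mathbb{E}[V(A(t,X(t))X(t))\mid\mathcal{F}_t]\le\lambda V(X(t))$ a.s. for all $t\ge0$. A non-negative square matrix is stochastic if each row sums to one, and doubly stochastic if it and its transpose are stochastic. *)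

(* Defs.v *)
From HB Require Import structures.
From mathcomp Require Import all_boot all_order all_algebra.
From mathcomp Require Import all_classical all_reals all_analysis.

Set Implicit Arguments.
Unset Strict Implicit.
Unset Printing Implicit Defensive.

Import Order.TTheory GRing.Theory Num.Theory.
Import numFieldNormedType.Exports.

Local Open Scope classical_set_scope.
Local Open Scope ring_scope.

Section Euclidean.
Context {R : realType}.

(* The library norm `|x| on matrices is the sup norm, so the Euclidean norm is
   introduced separately. *)
Definition dot (d : nat) (u v : 'rV[R]_d) : R := \sum_(k < d) u 0 k * v 0 k.

Definition enorm (d : nat) (u : 'rV[R]_d) : R := Num.sqrt (dot u u).

Definition subdifferential (d : nat) (f : 'rV[R]_d -> R) (w : 'rV[R]_d) :
    set 'rV[R]_d :=
  [set g | forall v, f w + dot g (v - w) <= f v].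

Definition argmin (d : nat) (f : 'rV[R]_d -> R) : set 'rV[R]_d :=
  [set w | forall v, f w <= f v].

Definition avg (n d : nat) (X : 'M[R]_(n, d)) : 'rV[R]_d :=
  n%:R^-1 *: \sum_(i < n) row i X.

Definition V (n d : nat) (X : 'M[R]_(n, d)) : R :=
  \sum_(i < n) enorm (row i X - avg X) ^+ 2.

Definition stochastic (n : nat) (M : 'M[R]_n) : Prop :=
  (forall i j, 0 <= M i j) /\ (forall i, \sum_(j < n) M i j = 1).

Definition doubly_stochastic (n : nat) (M : 'M[R]_n) : Prop :=
  stochastic M /\ stochastic M^T.

End Euclidean.

Definition connected_graph (n : nat) (e : rel 'I_n) : Prop :=
  [/\ symmetric e, irreflexive e & forall i j, connect e i j].

Section Random.
Context {R : realType} {disp : measure_display} {Omega : measurableType disp}.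

(* Matrix spaces carry no measurable structure in the library. Their Borel
   sigma-algebra is generated by the coordinate maps, so measurability of a
   random matrix, and the sigma-algebra it generates, are given by entries. *)
Definition random_matrix (m n : nat) (M : Omega -> 'M[R]_(m, n)) : Prop :=
  forall i j, measurable_fun [set: Omega] (fun omega => M omega i j).

Definition matrix_events (m n : nat) (M : Omega -> 'M[R]_(m, n)) :
    set (set Omega) :=
  \bigcup_(ij : 'I_m * 'I_n)
    preimage_set_system [set: Omega] (fun omega => M omega ij.1 ij.2) measurable.

(* A t x omega is the random matrix A(t, x), which may depend on the state x. *)
Definition at_state (n d : nat) (A : nat -> 'M[R]_(n, d) -> Omega -> 'M[R]_n)
    (X : nat -> Omega -> 'M[R]_(n, d)) (t : nat) (omega : Omega) : 'M[R]_n :=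
  A t (X t omega) omega.

(* sigma(X(0), .., X(t), A(0, X(0)), .., A(t - 1, X(t - 1))) *)
Definition history (n d : nat) (A : nat -> 'M[R]_(n, d) -> Omega -> 'M[R]_n)
    (X : nat -> Omega -> 'M[R]_(n, d)) (t : nat) : set (set Omega) :=
  <<s (\bigcup_(s in `I_t.+1) matrix_events (X s)) `|`
      (\bigcup_(s in `I_t) matrix_events (at_state A X s)) >>.

(* Y is a version of E[Z | F]. *)
Definition is_cond_expectation (P : probability Omega R) (F : set (set Omega))
    (Z Y : Omega -> R) : Prop :=
  [/\ P.-integrable [set: Omega] (EFin \o Z),
      P.-integrable [set: Omega] (EFin \o Y),
      preimage_set_system [set: Omega] Y measurable `<=` F &
      forall B, F B ->
        (\int[P]_(omega in B) (Y omega)%:E =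
         \int[P]_(omega in B) (Z omega)%:E)%E].

(* Conditional expectations are unique up to P-null sets, so the choice of the
   version Y is immaterial. *)
Definition contracting (P : probability Omega R) (n d : nat)
    (A : nat -> 'M[R]_(n, d) -> Omega -> 'M[R]_n)
    (X : nat -> Omega -> 'M[R]_(n, d)) : Prop :=
  exists2 lambda : R, 0 < lambda < 1 &
    forall t, exists2 Y : Omega -> R,
      is_cond_expectation P (history A X t)
        (fun omega => V (at_state A X t omega *m X t omega)) Y &
      \forall omega \ae P, Y omega <= lambda * V (X t omega).

End Random.

(* Main.v *)
Require Import Defs.
From HB Require Import structures.
From mathcomp Require Import all_boot all_order all_algebra.
From mathcomp Require Import ring lra.
From mathcomp Require Import all_classical all_reals all_analysis.
From mathcomp Require Import measurable_realfun.

Set Implicit Arguments.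
Unset Strict Implicit.
Unset Printing Implicit Defensive.

Import Order.TTheory GRing.Theory Num.Theory.
Import numFieldNormedType.Exports.

Local Open Scope classical_set_scope.
Local Open Scope ring_scope.

(** The randomness enters through one estimate, and everything else happens on a
    fixed sample path.

    Write [V] for the dispersion of the rows around their mean. Taking total
    expectations in the contraction hypothesis and using that a subgradient
    step of length [a] multiplies [V] by at most [1 + eps], up to an error
    [O(a ^+ 2)], the numbers [E (V (W t.+1))] satisfy
    [u t.+1 <= rho * u t + O(alpha t.+1 ^+ 2)] with [rho < 1], for
    the choice [eps = 1 - lambda]. The squared steps being summable, so are these
    expectations, hence almost surely [\sum_t V (W t.+1)] is finite
    ([contracting_dispersion_summable]).

    On such a path, let [c t] be the mean of the rows of [W t.+1] and let [w]
    be a minimizer of [F]. Averaging by a doubly stochastic matrix does not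
    increase [sqdist _ w], the sum of the squared distances of the rows to [w];
    together with the subgradient inequalities at the rows and at [c t], this
    gives ([sqdist_subgradient_step])
[[
    sqdist (W t.+2) w <=
      sqdist (W t.+1) w - 2 * alpha t.+1 * (F (c t) - F w) + b t
]]
    with [b t = O(alpha t.+1 ^+ 2) + V (W t.+1)] summable: the error
    is of the size of [alpha t.+1] times the distance of the rows to [c t], and
    Young's inequality splits it into these two parts. Consequently [sqdist (W t.+1) w]
    converges for every minimizer [w] and [\sum_t alpha t.+1 * (F (c t) - F w)]
    is finite ([quasi_fejer]); since [\sum_t alpha t] diverges, [F (c t)] gets
    arbitrarily close to the minimum at arbitrarily late times. The bounded
    sequence [c] has a cluster point [x] along such times, [x] is a minimizer,
    and [sqdist (W t.+1) x], which converges and is arbitrarily small at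
    arbitrarily late times, tends to [0].

    Subgradients of [f i] at [c t] and at [x] are used although the iteration
    only supplies them at the rows of [W]; they exist because a convex function
    on a finite-dimensional space has a subgradient at every point
    ([subdifferential_nonempty]), and the bound [L i] holds for them too. *)

(** * The inner product and the existence of subgradients *)

Section InnerProduct.
Context {R : realType} {d : nat}.
Implicit Types u v w : 'rV[R]_d.

Lemma dotC u v : dot u v = dot v u.
Proof. by apply: eq_bigr => k _; rewrite mulrC. Qed.

Lemma dotDl u v w : dot (u + v) w = dot u w + dot v w.
Proof. by rewrite -big_split; apply: eq_bigr => k _; rewrite mxE mulrDl. Qed.

Lemma dotZl a u v : dot (a *: u) v = a * dot u v.
Proof. by rewrite mulr_sumr; apply: eq_bigr => k _; rewrite mxE mulrA. Qed.

Lemma dotDr u v w : dot w (u + v) = dot w u + dot w v.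
Proof. by rewrite dotC dotDl !(dotC w). Qed.

Lemma dotZr a u v : dot u (a *: v) = a * dot u v.
Proof. by rewrite dotC dotZl dotC. Qed.

Lemma dotNl u v : dot (- u) v = - dot u v.
Proof. by rewrite -scaleN1r dotZl mulN1r. Qed.

Lemma dotNr u v : dot u (- v) = - dot u v.
Proof. by rewrite dotC dotNl dotC. Qed.

Lemma dot0l v : dot 0 v = 0.
Proof. by rewrite /dot big1 // => k _; rewrite mxE mul0r. Qed.

Lemma dot_suml (I : Type) (r : seq I) (Q : pred I) (g : I -> 'rV[R]_d) v :
  dot (\sum_(i <- r | Q i) g i) v = \sum_(i <- r | Q i) dot (g i) v.
Proof.
apply: (big_morph (fun u => dot u v)) => [u w|]; first exact: dotDl.
exact: dot0l.
Qed.

Lemma dot_ge0 u : 0 <= dot u u.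
Proof. by apply: sumr_ge0 => k _; rewrite -expr2 sqr_ge0. Qed.

Lemma enorm_sqr u : enorm u ^+ 2 = dot u u.
Proof. by rewrite /enorm sqr_sqrtr // dot_ge0. Qed.

Lemma dot_le_sqr u (L : R) : enorm u <= L -> dot u u <= L ^+ 2.
Proof.
by move=> uL; rewrite -enorm_sqr lerXn2r // nnegrE ?(le_trans _ uL) ?sqrtr_ge0.
Qed.

Lemma sqr_coord_le_dot u k : u 0 k ^+ 2 <= dot u u.
Proof.
rewrite /dot (bigD1 k) //= -expr2 lerDl.
by apply: sumr_ge0 => j _; rewrite -expr2 sqr_ge0.
Qed.

(** Young's inequality, obtained by expanding the square of [u + v]. *)
Lemma dot_young u v : - (2 * dot u v) <= dot u u + dot v v.
Proof.
by have := dot_ge0 (u + v); rewrite !dotDl !dotDr (dotC v u); lra.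
Qed.

(** The weighted form of [(a + b) ^+ 2 <= 2 * (a ^+ 2 + b ^+ 2)]: the factor of
    the first term can be taken as close to [1] as desired, which is what keeps
    a contraction contracting after a small perturbation. *)
Lemma dotD_weighted (eps : R) u v : 0 < eps ->
  dot (u + v) (u + v) <= (1 + eps) * dot u u + (1 + eps^-1) * dot v v.
Proof.
move=> e0; have := dot_ge0 (eps *: u - v).
rewrite !dotDl !dotDr !dotNl !dotNr !dotZl !dotZr (dotC v u) => h.
have ec : eps * eps^-1 = 1 by rewrite mulfV // gt_eqF.
have c0 : 0 < eps^-1 by rewrite invr_gt0.
move: (eps^-1) ec c0 h => c ec c0 /(mulr_ge0 (ltW c0)).
have -> : c * (eps * (eps * dot u u) - eps * dot u v
      + (- (eps * dot u v) - - dot v v)) =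
    (eps * c) * (eps * dot u u) - 2 * (eps * c) * dot u v + c * dot v v by ring.
by rewrite ec; lra.
Qed.

End InnerProduct.

Section Subgradient.
Context {R : realType}.

(** Convexity with unnormalized weights, which spares divisions by [p + q]
    when two difference quotients are compared. *)
Lemma convex_pair (E : lmodType R) (f : E -> R) (x y : E) (p q : R) :
  convex_function [set: E] f -> 0 < p -> 0 < q ->
  (p + q) * f ((p + q)^-1 *: (p *: x + q *: y)) <= p * f x + q * f y.
Proof.
move=> cf p0 q0; have pq0 : 0 < p + q by rewrite addr_gt0.
have pqn0 : p + q != 0 by rewrite gt_eqF.
have t0 : 0 <= p / (p + q) by rewrite divr_ge0 ?ltW.
have t1 : p / (p + q) <= 1 by rewrite ler_pdivrMr // mul1r lerDl ltW.
have := cf (Itv01 t0 t1) x y (in_setT _) (in_setT _).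
rewrite /conv /= /unstable.onem.
have -> : 1 - p / (p + q) = q / (p + q) by field.
rewrite scalerDr !scalerA ![_^-1 * _]mulrC => h.
rewrite -(ler_pM2l (x := (p + q)^-1)) ?invr_gt0 // mulrA mulVf // mul1r.
have -> : (p + q)^-1 * (p * f x + q * f y) =
    p / (p + q) * f x + (1 - p / (p + q)) * f y by field.
exact: h.
Qed.

(** The one-dimensional step of the Hahn-Banach theorem. An admissible slope
    [a] along [e] has to lie above all the backward difference quotients
    [r^-1 * (f w + l v - f (w + v - r *: e))] and below all the forward ones;
    by convexity every backward quotient is at most every forward one, so the
    supremum of the backward quotients is admissible. *)
Lemma affine_minorant_extension (E : lmodType R) (f : E -> R) (w e : E)
    (S : set E) (l : {scalar E}) :
  convex_function [set: E] f ->
  S 0 -> (forall a b u v, S u -> S v -> S (a *: u + b *: v)) ->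
  (forall v, S v -> f w + l v <= f (w + v)) ->
  exists a, forall v s, S v -> f w + l v + a * s <= f (w + v + s *: e).
Proof.
move=> cf S0 Slin minor.
pose lower : set R := [set a | exists v r,
  [/\ S v, 0 < r & a = r^-1 * (f w + l v - f (w + v - r *: e))]].
have gap u v s r : S u -> S v -> 0 < s -> 0 < r ->
    r^-1 * (f w + l v - f (w + v - r *: e)) <=
    s^-1 * (f (w + u + s *: e) - f w - l u).
  move=> Su Sv s0 r0; rewrite ler_pdivrMl // mulrCA ler_pdivlMl //.
  have rs0 : r + s != 0 by rewrite gt_eqF // addr_gt0.
  have := convex_pair (w + u + s *: e) (w + v - r *: e) cf r0 s0.
  pose m := (r + s)^-1 *: (r *: u + s *: v).
  have -> : (r + s)^-1 *: (r *: (w + u + s *: e) + s *: (w + v - r *: e))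
      = w + m.
    rewrite /m -[w in RHS](scale1r) -(mulVf rs0) -scalerA -scalerDr.
    congr (_ *: _); rewrite !scalerDr !scalerN !scalerA scalerDl.
    rewrite [s * r]mulrC -!addrA; congr (_ + _).
    rewrite [RHS]addrCA; congr (_ + _).
    rewrite [LHS]addrCA; congr (_ + _).
    by rewrite [LHS]addrCA subrr addr0.
  have Sm : S m by rewrite /m scalerDr !scalerA; exact: Slin.
  have := minor _ Sm; rewrite {1}/m linearZ linearD !linearZ /= => hm h.
  have := ler_wpM2l (ltW (addr_gt0 r0 s0)) hm.
  rewrite mulrDr mulrA mulfV // mul1r; nra.
have lower0 : lower !=set0.
  by exists (1^-1 * (f w + l 0 - f (w + 0 - 1 *: e))), 0, 1.
have gap' u s : S u -> 0 < s ->
    sup lower <= s^-1 * (f (w + u + s *: e) - f w - l u).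
  by move=> Su s0; apply: ge_sup => // _ [v [r [Sv r0 ->]]]; exact: gap.
have le_lower v r : S v -> 0 < r ->
    r^-1 * (f w + l v - f (w + v - r *: e)) <= sup lower.
  move=> Sv r0; apply: ub_le_sup; last by exists v, r.
  exists (1^-1 * (f (w + 0 + 1 *: e) - f w - l 0)) => _ [u [s [Su s0 ->]]].
  exact: gap.
exists (sup lower) => v s Sv; have [s0|s0|->] := ltrgt0P s.
- by have := gap' _ _ Sv s0; rewrite ler_pdivlMl //; lra.
- have r0 : 0 < - s by rewrite oppr_gt0.
  by have := le_lower _ _ Sv r0; rewrite scaleNr opprK ler_pdivrMl //; lra.
- by rewrite mulr0 scale0r !addr0; exact: minor.
Qed.

Lemma dot_is_linear d (g : 'rV[R]_d) : linear_for *%R (dot g).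
Proof. by move=> a u v; rewrite dotDr dotZr. Qed.

(** The affine minorant [f w] on the trivial subspace is extended one
    coordinate at a time: [S k] is the span of the first [k] basis vectors. *)
Lemma subdifferential_nonempty d (f : 'rV[R]_d -> R) (w : 'rV[R]_d) :
  convex_function [set: 'rV[R]_d] f -> subdifferential f w !=set0.
Proof.
move=> cf; pose S k : set 'rV[R]_d := 
  [set v | forall j : 'I_d, (k <= j)%N -> v 0 j = 0].
suff /(_ d (leqnn d)) [g gP] : forall k, (k <= d)%N ->
    exists g, forall v, S k v -> f w + dot g v <= f (w + v).
  exists g => v; rewrite -[in leRHS](subrKC w v); apply: gP => j.
  by rewrite leqNgt ltn_ord.
elim=> [_|k IH kd].
  exists 0 => v S0v; suff -> : v = 0.
    by rewrite dot0l !addr0.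
  by apply/rowP => j; rewrite S0v // mxE.
have [g gP] := IH (ltnW kd); pose k' := Ordinal kd.
pose e : 'rV[R]_d := delta_mx 0 k'.
pose linm := GRing.isLinear.Build R 'rV[R]_d R *%R (dot g) (dot_is_linear g).
pose l : {scalar 'rV[R]_d} := HB.pack (dot g) linm.
have dote u : dot e u = u 0 k'.
  rewrite /dot (bigD1 k') //= mxE !eqxx mul1r big1 ?addr0 // => j jk.
  by rewrite mxE (negbTE jk) andbF mul0r.
have Slin a b u v : S k u -> S k v -> S k (a *: u + b *: v).
  by move=> Su Sv j kj; rewrite !mxE Su // Sv // !mulr0 addr0.
have S0 : S k 0 by move=> j _; rewrite mxE.
have [a aP] := @affine_minorant_extension _ f w e (S k) l cf S0 Slin gP.
(* The coefficient of [g] along [e] is replaced by the slope [a]. *)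
exists (g + (a - g 0 k') *: e) => u Su.
have Sv : S k (u - u 0 k' *: e).
  move=> j kj; rewrite !mxE eqxx /=; have [->|jk] := eqVneq j k'.
    by rewrite mulr1 subrr.
  rewrite mulr0 subr0 Su // ltn_neqAle kj andbT eq_sym.
  by apply: contra_neq jk => jk; apply: val_inj.
have := aP _ (u 0 k') Sv; rewrite /= -(addrA w) subrK.
rewrite dotDr dotNr dotZr (dotC g e) dote dotDl dotZl dote; lra.
Qed.

End Subgradient.

(** * Dispersion and one step of the method *)

Section Dispersion.
Context {R : realType} {n d : nat}.
Implicit Types (X W : 'M[R]_(n, d)) (w c : 'rV[R]_d).

Definition sqdist X w : R := \sum_(i < n) dot (row i X - w) (row i X - w).

Lemma sqdist_ge0 X w : 0 <= sqdist X w.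
Proof. by apply: sumr_ge0 => i _; exact: dot_ge0. Qed.

Lemma V_sqdist X : V X = sqdist X (avg X).
Proof. by apply: eq_bigr => i _; exact: enorm_sqr. Qed.

Lemma dot_row_le_sqdist X w i : dot (row i X - w) (row i X - w) <= sqdist X w.
Proof.
rewrite /sqdist (bigD1 i) //= lerDl.
by apply: sumr_ge0 => j _; exact: dot_ge0.
Qed.

(** Huygens' identity: the cross terms vanish because the rows are centered at
    their mean. *)
Lemma sqdist_V X c :
  sqdist X c = V X + n%:R * dot (avg X - c) (avg X - c).
Proof.
rewrite V_sqdist; set m := avg X.
have centered : \sum_(i < n) (row i X - m) = 0.
  rewrite sumrB sumr_const card_ord /m /avg -scaler_nat.
  have [n0|n_gt0] := posnP n.
    have no_row (i : 'I_n) : False by move: (ltn_ord i); rewrite {2}n0.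
    by rewrite !big1 ?scaler0 ?subr0 // => i; case: (no_row i).
  by rewrite scalerA mulfV ?scale1r ?subrr // pnatr_eq0 -lt0n.
have -> : sqdist X c = sqdist X m + 2 * dot (\sum_(i < n) (row i X - m)) (m - c)
    + \sum_(i < n) dot (m - c) (m - c).
  rewrite dot_suml mulr_sumr -!big_split /=; apply: eq_bigr => i _.
  have -> : row i X - c = (row i X - m) + (m - c) by rewrite addrA subrK.
  by rewrite [LHS]dotDl !(dotDr (row i X - m)) (dotC (m - c) (row i X - m)); ring.
by rewrite centered dot0l mulr0 addr0 sumr_const card_ord mulr_natl.
Qed.

Lemma V_le_sqdist X c : V X <= sqdist X c.
Proof. by rewrite sqdist_V lerDl mulr_ge0 ?dot_ge0. Qed.

(** Jensen's inequality for the squared norm, from the nonnegativity of the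
    weighted variance. *)
Lemma dot_jensen (I : finType) (a : I -> R) (y : I -> 'rV[R]_d) :
  (forall j, 0 <= a j) -> \sum_j a j = 1 ->
  dot (\sum_j a j *: y j) (\sum_j a j *: y j) <= \sum_j a j * dot (y j) (y j).
Proof.
move=> a0 a1; set m := \sum_j _.
have : 0 <= \sum_j a j * dot (y j - m) (y j - m).
  by apply: sumr_ge0 => j _; rewrite mulr_ge0 // dot_ge0.
have mm : dot m m = \sum_j a j * dot (y j) m.
  by rewrite {1}/m dot_suml; apply: eq_bigr => j _; rewrite dotZl.
suff -> : \sum_j a j * dot (y j - m) (y j - m) =
    \sum_j a j * dot (y j) (y j) - 2 * (\sum_j a j * dot (y j) m)
      + (\sum_j a j) * dot m m.
  by rewrite a1 -mm; lra.
rewrite mulr_sumr mulr_suml -sumrB -big_split /=; apply: eq_bigr => j _.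
by rewrite dotDl !dotDr !dotNl !dotNr (dotC m (y j)); ring.
Qed.

(** The row sums allow Jensen's inequality on each row of the product; the
    column sums then make the total weight of each row of [X] equal to [1]. *)
Lemma sqdist_doubly_stochastic (M : 'M[R]_n) X w :
  doubly_stochastic M -> sqdist (M *m X) w <= sqdist X w.
Proof.
move=> [[M0 Mr] [_ Mc]].
have rowM i : row i (M *m X) - w = \sum_j M i j *: (row j X - w).
  rewrite (eq_bigr (fun j => M i j *: row j X - M i j *: w)); last first.
    by move=> j _; rewrite scalerBr.
  rewrite sumrB -scaler_suml Mr scale1r row_mul mulmx_sum_row; congr (_ - _).
  by apply: eq_bigr => j _; rewrite mxE.
apply: (@le_trans _ _ (\sum_i \sum_j M i j * dot (row j X - w) (row j X - w))).
  by apply: ler_sum => i _; rewrite rowM; exact: dot_jensen.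
rewrite exchange_big /=; apply: ler_sum => j _; rewrite -mulr_suml.
suff -> : \sum_i M i j = 1 by rewrite mul1r.
by rewrite -(Mc j); apply: eq_bigr => i _; rewrite mxE.
Qed.

(** [V] is at most the squared distance to any point, in particular to the mean
    of the rows before the step. *)
Lemma V_subgradient_step (eps a : R) (L : 'I_n -> R) W (G : 'M[R]_(n, d)) :
  0 < eps -> (forall i, enorm (row i G) <= L i) ->
  V (W - a *: G) <=
    (1 + eps) * V W + (1 + eps^-1) * (\sum_i L i ^+ 2) * a ^+ 2.
Proof.
move=> e0 GL; apply: (le_trans (V_le_sqdist _ (avg W))).
rewrite V_sqdist /sqdist mulr_sumr -mulrA mulr_suml mulr_sumr -big_split /=.
apply: ler_sum => i _; rewrite linearB linearZ /= addrAC.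
apply: (le_trans (dotD_weighted _ _ e0)); rewrite lerD2l ler_wpM2l //.
  by rewrite addr_ge0 // invr_ge0 ltW.
rewrite dotNl dotNr opprK dotZl dotZr mulrA -expr2 mulrC.
by rewrite ler_wpM2r ?sqr_ge0 // dot_le_sqr.
Qed.

(** The descent inequality. Each row is compared to a common point [c]: passing
    from [f i (row i W)] to [f i c] costs [2 * a * dot (h i) (row i W - c)],
    which Young's inequality bounds by [a ^+ 2 * L i ^+ 2] plus the squared
    distance of the row to [c]. Both are summable over time, whereas the
    product itself is only known to be so through this splitting. *)
Lemma sqdist_subgradient_step (f : 'I_n -> 'rV[R]_d -> R) (a : R)
    (L : 'I_n -> R) W (G : 'M[R]_(n, d)) (h : 'I_n -> 'rV[R]_d) w c :
  0 <= a ->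
  (forall i, subdifferential (f i) (row i W) (row i G)) ->
  (forall i, enorm (row i G) <= L i) ->
  (forall i, subdifferential (f i) c (h i)) ->
  (forall i, enorm (h i) <= L i) ->
  sqdist (W - a *: G) w <= sqdist W w
    - 2 * a * (\sum_i f i c - \sum_i f i w)
    + (2 * (\sum_i L i ^+ 2) * a ^+ 2 + sqdist W c).
Proof.
move=> a0 Gsub GL hsub hL.
rewrite /sqdist -sumrB [X in _ - X + _]mulr_sumr -sumrB [X in X * a ^+ 2]mulr_sumr.
rewrite mulr_suml -!big_split /=; apply: ler_sum => i _; rewrite linearB linearZ /= addrAC.
set x := row i W; set g := row i G.
have h1 := ler_wpM2l a0 (Gsub i w).
have h2 := ler_wpM2l a0 (hsub i x).
have h3 := dot_young (a *: h i) (x - c).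
have h4 : a ^+ 2 * dot (h i) (h i) <= a ^+ 2 * L i ^+ 2.
  by rewrite ler_wpM2l ?sqr_ge0 // dot_le_sqr.
have h5 : a ^+ 2 * dot g g <= a ^+ 2 * L i ^+ 2.
  by rewrite ler_wpM2l ?sqr_ge0 // dot_le_sqr // GL.
rewrite !dotZl dotZr in h3.
rewrite -/x -/g -[w - x]opprB dotNr (dotC g) in h1.
move: (x - w) (x - c) h1 h2 h3 => y z h1 h2 h3.
rewrite dotDl !dotDr !dotNl !dotNr !dotZr !dotZl (dotC g y); lra.
Qed.

End Dispersion.

(** * Sequences of reals and of vectors *)

Section RealSequences.
Context {R : realType}.
Implicit Types u a b : R ^nat.

Lemma cvgn_series_ub b : cvgn (series b) -> exists B, forall N, series b N <= B.
Proof.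
move=> /cvg_seq_bounded /pinfty_ex_gt0 [M _ bM]; exists M => N.
by apply: le_trans (ler_norm _) _; exact: bM.
Qed.

Lemma nneg_series_ub_cvgn a M :
  (forall t, 0 <= a t) -> (forall N, series a N <= M) -> cvgn (series a).
Proof.
move=> a0 aM; apply: nondecreasing_is_cvgn; last first.
  by exists M => _ [N _ <-].
by apply: nondecreasing_series => k _ _; exact: a0.
Qed.

(** [u + series a - series b] is nonincreasing and bounded below. *)
Lemma quasi_fejer u a b :
  (forall t, 0 <= u t) -> (forall t, 0 <= a t) -> cvgn (series b) ->
  (forall t, u t.+1 <= u t - a t + b t) ->
  (exists M, forall N, series a N <= M) /\ cvgn u.
Proof.
move=> u0 a0 cb step.
have [B bB] := cvgn_series_ub cb.
pose z t := u t + series a t - series b t.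
have zdecr : nonincreasing_seq z.
  apply/nonincreasing_seqP => t; rewrite /z !seriesSr.
  by have := step t; lra.
have z0 : z 0%N = u 0%N by rewrite /z /series /= !big_geq // subr0 addr0.
have aub N : series a N <= u 0%N + B.
  have := zdecr _ _ (leq0n N); rewrite z0 /z.
  by have := bB N; have := u0 N; lra.
split; first by exists (u 0%N + B).
have ca := nneg_series_ub_cvgn a0 aub.
have cz : cvgn z.
  apply: nonincreasing_is_cvgn => //; exists (- B) => _ [N _ <-].
  have sa0 : 0 <= series a N by apply: sumr_ge0 => k _; exact: a0.
  by rewrite /z; have := bB N; have := u0 N; lra.
have -> : u = (z - series a + series b)%R.
  by apply/funext => t; rewrite /z !fctE; lra.
by apply: is_cvgD => //; apply: is_cvgB.
Qed.

(** Otherwise the partial sums of [a * gap] would eventually dominate [eps] times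
    those of [a]. *)
Lemma frequently_small (a gap : R ^nat) M :
  (forall t, 0 < a t) -> (forall K, exists N, K < series a N) ->
  (forall t, 0 <= gap t) -> (forall N, series (fun t => a t * gap t) N <= M) ->
  forall eps T, 0 < eps -> exists2 t, (T <= t)%N & gap t < eps.
Proof.
move=> a0 aoo gap0 sM eps T e0; apply: contrapT => no.
have large t : (T <= t)%N -> eps <= gap t.
  by move=> Tt; rewrite leNgt; apply/negP => small; apply: no; exists t.
have [N NK] := aoo (series a T + M / eps).
suff : eps * (series a N - series a T) <= M.
  have : M = eps * (M / eps) by rewrite mulrCA mulfV ?mulr1 // gt_eqF.
  move=> {1}-> h; have := ltr_pM2l e0 (M / eps) (series a N - series a T).
  by rewrite ltNge h => /esym; lra.
apply: le_trans (sM N).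
have [NT|TN] := leqP N T.
  have : series a N <= series a T.
    by apply: nondecreasing_series => // k _ _; exact: ltW.
  have : 0 <= series (fun t => a t * gap t) N.
    by apply: sumr_ge0 => k _; rewrite mulr_ge0 // ltW.
  nra.
have split_at b : series b N = series b T + \sum_(T <= k < N) b k.
  by rewrite /series /= (big_cat_nat (n := T)) // ltnW.
rewrite !split_at addrAC subrr add0r -[leLHS]add0r lerD //.
  by apply: sumr_ge0 => k _; rewrite mulr_ge0 // ltW.
rewrite mulr_sumr; apply: ler_sum_nat => k /andP[Tk _].
by rewrite mulrC; apply: ler_wpM2l; [exact: ltW|exact: large].
Qed.

(** A positive limit would keep the sequence away from [0] at late times. *)
Lemma cvg_frequently_small_0 u : cvgn u -> (forall t, 0 <= u t) ->
  (forall eps T, 0 < eps -> exists2 t, (T <= t)%N & u t < eps) ->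
  u @ \oo --> (0 : R).
Proof.
move=> cu u0 small; suff <- : limn u = 0 by [].
apply/eqP; rewrite eq_le limr_ge //=; last exact: nearW.
rewrite leNgt; apply/negP => l0.
have /cvgrPdist_lt /(_ (limn u / 2)) [|T _ uT] := cu; first by lra.
have [t Tt ut] := small (limn u / 2) T ltac:(lra).
have := uT t Tt; have := ler_norm (limn u - u t); lra.
Qed.

End RealSequences.

Section RowVectorLimits.
Context {R : realType} {d : nat}.
Implicit Types (v : nat -> 'rV[R]_d).

Lemma dot_dist_cvg0 v (a : 'rV[R]_d) :
  (fun t => dot (v t - a) (v t - a)) @ \oo --> (0 : R) -> v @ \oo --> a.
Proof.
move=> h; apply/cvg_ballP => eps e0.
have e2 : 0 < eps ^+ 2 by rewrite exprn_gt0.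
move/cvgrPdist_lt: h => /(_ _ e2) [T _ hT]; exists T => // t Tt; split => //.
move=> i j; rewrite ord1 /ball /=.
have := hT t Tt; rewrite sub0r normrN ger0_norm ?dot_ge0 // => lt_eps.
have := le_lt_trans (sqr_coord_le_dot _ j) lt_eps.
rewrite !mxE -[X in X < _]real_normK ?num_real // distrC.
by rewrite ltr_pXn2r // nnegrE ltW.
Qed.

Lemma dot_dist_cvg (F : set_system 'rV[R]_d) {FF : Filter F}
    (a v : 'rV[R]_d) :
  (forall k, x 0 k @[x --> F] --> v 0 k) ->
  dot (x - a) (x - a) @[x --> F] --> dot (v - a) (v - a).
Proof.
move=> xv; apply: (cvg_big (P := predT) (@add_continuous R)) => k _.
have coord : (x - a) 0 k @[x --> F] --> (v - a) 0 k.
  under eq_fun do rewrite !mxE; rewrite !mxE.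
  exact: (cvgB (xv k) (cvg_cst (a 0 k))).
exact: (cvgM coord coord).
Qed.

Lemma dot_dist_continuous (a : 'rV[R]_d) :
  continuous (fun v : 'rV[R]_d => dot (v - a) (v - a)).
Proof.
move=> v; apply: (@dot_dist_cvg (nbhs v) (nbhs_filter v)) => k.
exact: (@coord_continuous R 1 d 0 k v).
Qed.

(** Bolzano-Weierstrass in the Euclidean norm, phrased without extracting a
    subsequence. *)
Lemma bounded_row_cluster v (a : 'rV[R]_d) M :
  (forall t, dot (v t - a) (v t - a) <= M) ->
  exists x : 'rV[R]_d, forall eps T, 0 < eps ->
    exists2 t, (T <= t)%N & dot (v t - x) (v t - x) < eps.
Proof.
move=> vM.
pose box (j : 'I_d) : set R := `[a 0 j - (M + 1), a 0 j + (M + 1)]%classic.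
pose K : set 'rV[R]_d := [set x | forall j, box j (x 0 j)].
have cK : compact K by apply: rV_compact => j; exact: segment_compact.
have vK : (v @ \oo) K.
  exists 0%N => // t _ j; rewrite /box /= in_itv /=.
  have := le_trans (sqr_coord_le_dot _ j) (vM t); rewrite !mxE.
  move: (v t 0 j) (a 0 j) => y z le_M.
  have := sqr_ge0 (y - z); have := sqr_ge0 (y - z - 1).
  by have := sqr_ge0 (y - z + 1); nra.
have [x [_ xcl]] := cK _ _ vK.
exists x => eps T e0.
have near_x : nbhs x [set y : 'rV[R]_d | dot (y - x) (y - x) < eps].
  have xx0 : dot (x - x) (x - x) = 0 by rewrite subrr dot0l.
  have /cvgrPdist_lt /(_ _ e0) := @dot_dist_continuous x x.
  apply: filterS => y; rewrite /= xx0.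
  by rewrite sub0r normrN ger0_norm ?dot_ge0.
have tail : (v @ \oo) [set v t | t in [set t | (T <= t)%N]].
  by exists T => // t /= Tt; exists t.
by have [_ [[t Tt <-] /= lt_eps]] := xcl _ _ tail near_x; exists t.
Qed.

End RowVectorLimits.

(** * Convergence along one path *)

Section PathConvergence.
Context {R : realType}.

(** Bolzano-Weierstrass along the times at which [gap] is small: the cluster
    point is that of [v \o phi], where [phi k] is a time after [k] at which
    [gap] is below [1 / (k + 1)]. *)
Lemma frequent_cluster d (v : nat -> 'rV[R]_d) (a : 'rV[R]_d) (M : R)
    (gap : R ^nat) :
  (forall t, dot (v t - a) (v t - a) <= M) ->
  (forall eps T, 0 < eps -> exists2 t, (T <= t)%N & gap t < eps) ->
  exists x : 'rV[R]_d, forall eps T, 0 < eps ->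
    exists t, [/\ (T <= t)%N, gap t < eps & dot (v t - x) (v t - x) < eps].
Proof.
move=> vM small.
have /choice [phi phiP] : forall k, exists t, (k <= t)%N /\ gap t < k.+1%:R^-1.
  move=> k; have [t kt gt] := small k.+1%:R^-1 k ltac:(by rewrite invr_gt0).
  by exists t.
have [x xP] := bounded_row_cluster (fun k => vM (phi k)).
exists x => eps T e0.
have /cvgrPdist_lt /(_ _ e0) [N _ hN] := @cvg_harmonic R.
have [k Tk lt_eps] := xP eps (maxn T N) e0.
have [le_phi gap_phi] := phiP k; exists (phi k); split => //.
  exact: leq_trans (leq_maxl T N) (leq_trans Tk le_phi).
apply: lt_trans gap_phi _; apply: le_lt_trans (hN k _).
  by rewrite /= sub0r normrN; exact: ler_norm.
exact: leq_trans (leq_maxr T N) Tk.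
Qed.

(** Lower semicontinuity of [F] at [x]: the affine minorant given by a single
    subgradient [H] at [x] is continuous. The scale [s] makes the error terms
    [s * (dot H H + 3)] smaller than twice the excess [delta] of [F x]
    over [m]. *)
Lemma subgradient_frequent_limit_le d (F : 'rV[R]_d -> R) (x H : 'rV[R]_d) (m : R) :
  subdifferential F x H ->
  (forall eps, 0 < eps ->
    exists2 v, F v - m < eps & dot (v - x) (v - x) < eps) ->
  F x <= m.
Proof.
move=> xH close; rewrite leNgt; apply/negP => m_lt.
pose delta := F x - m; have d0 : 0 < delta by rewrite subr_gt0.
have HH0 := dot_ge0 H.
pose D := dot H H + 3 + delta; have D0 : 0 < D by rewrite /D; lra.
pose s := delta / D; have s0 : 0 < s by rewrite divr_gt0.
have sD : s * D = delta by rewrite /s mulfVK // gt_eqF.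
have [v Fv dv] := close (s ^+ 2) ltac:(by rewrite exprn_gt0).
have sub := xH v.
have young := dot_young (s *: H) (v - x).
rewrite !dotZl dotZr in young.
have s1 : s <= 1 by rewrite ler_pdivrMr // mul1r /D; lra.
have le1 : delta <= s ^+ 2 - dot H (v - x) by rewrite /delta; lra.
have le2 := ler_wpM2l (ltW s0) le1.
have le3 : s * (2 * delta) <= s * (s * (dot H H + 3)) by nra.
by move: le3; rewrite ler_pM2l // => le3; move: sD; rewrite /D; nra.
Qed.

(** The deterministic part of the convergence theorem: a path along which the
    dispersion is summable converges to a minimizer. The role of the Lyapunov
    function is played by [sqdist (W t.+1) w], for two choices of [w]: an
    arbitrary minimizer first, to produce boundedness and the cluster point
    [x], then [x] itself. *)
Lemma subgradient_path_cvg n d (f : 'I_n -> 'rV[R]_d -> R) (F : 'rV[R]_d -> R)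
    (L : 'I_n -> R) (M : nat -> 'M[R]_n) (X W G : nat -> 'M[R]_(n, d))
    (alpha : R ^nat) :
  (forall i, convex_function [set: 'rV[R]_d] (f i)) ->
  (forall w, F w = \sum_(i < n) f i w) ->
  argmin F !=set0 ->
  (forall i w g, subdifferential (f i) w g -> enorm g <= L i) ->
  (forall t, W t.+1 = M t *m X t) ->
  (forall t i, subdifferential (f i) (row i (W t.+1)) (row i (G t.+1))) ->
  (forall t, X t.+1 = W t.+1 - alpha t.+1 *: G t.+1) ->
  (forall t, doubly_stochastic (M t)) ->
  (forall t, 0 < alpha t.+1) ->
  (forall K, exists N, K < series (fun t => alpha t.+1) N) ->
  cvgn (series (fun t => alpha t.+1 ^+ 2)) ->
  cvgn (series (fun t => V (W t.+1))) ->
  exists2 w, argmin F w & forall i, (fun t => row i (W t)) @ \oo --> w.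
Proof.
move=> fconv Fdef [wopt wopt_min] fL Wstep Gsub Xstep Mds alpha0 alphaoo calpha cV.
have [n0|n_gt0] := posnP n.
  by exists wopt => // i; exfalso; move: (ltn_ord i); rewrite {2}n0.
pose c t := avg (W t.+1).
pose C := \sum_i L i ^+ 2.
pose b t := 2 * C * alpha t.+1 ^+ 2 + V (W t.+1).
have cb : cvgn (series b).
  have -> : series b = (fun N => 2 * C * series (fun t => alpha t.+1 ^+ 2) N)
      + series (fun t => V (W t.+1)).
    by apply/funext => N; rewrite !fctE /series /= big_split -mulr_sumr.
  by apply: is_cvgD => //; exact: is_cvgMr.
have subgrad x := choice (fun i => subdifferential_nonempty x (fconv i)).
have step w t : sqdist (W t.+2) w <=
    sqdist (W t.+1) w - 2 * alpha t.+1 * (F (c t) - F w) + b t.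
  have [h hP] := subgrad (c t).
  rewrite Wstep; apply: le_trans (sqdist_doubly_stochastic _ _ (Mds _)) _.
  rewrite Xstep !Fdef /b V_sqdist.
  apply: (sqdist_subgradient_step _ (ltW (alpha0 t)) (Gsub t) _ hP) => i.
    exact: fL (Gsub t i).
  exact: fL (hP i).
pose gap t := 2 * (F (c t) - F wopt).
have gap0 t : 0 <= gap t by rewrite mulr_ge0 // subr_ge0 wopt_min.
have fejer w : argmin F w ->
    (exists M', forall N, series (fun t => alpha t.+1 * gap t) N <= M') /\
    cvgn (fun t => sqdist (W t.+1) w).
  move=> w_min; apply: (@quasi_fejer _ _ _ b) => // [t|t|t].
  - exact: sqdist_ge0.
  - by rewrite mulr_ge0 // ltW.
  - apply: le_trans (step w t) _.
    have -> : F w = F wopt by apply/le_anti; rewrite w_min wopt_min.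
    by rewrite /gap mulrA (mulrC (alpha _)).
have [[S gapS] cwopt] := fejer _ wopt_min.
have small := frequently_small alpha0 alphaoo gap0 gapS.
have [B _ uB] := pinfty_ex_gt0 (cvg_seq_bounded cwopt).
have cB t : dot (c t - wopt) (c t - wopt) <= B.
  apply: le_trans (le_trans (ler_norm _) (uB t I)); rewrite sqdist_V.
  rewrite -[leLHS]add0r lerD //; first by rewrite V_sqdist sqdist_ge0.
  by rewrite ler_peMl ?dot_ge0 // ler1n.
have [x xP] := frequent_cluster cB small.
have x_min : argmin F x.
  have [h hP] := subgrad x.
  have xH : subdifferential F x (\sum_i h i).
    move=> v; rewrite !Fdef dot_suml -big_split /=.
    by apply: ler_sum => i _; exact: hP.
  move=> v; apply: le_trans (wopt_min v).
  apply: (subgradient_frequent_limit_le xH) => eps e0.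
  have [t [_ gt ct]] := xP eps 0%N e0; exists (c t) => //.
  by move: gt (gap0 t); rewrite /gap; lra.
exists x => // i.
have [_ cx] := fejer x x_min.
have dist0 : sqdist (W t.+1) x @[t --> \oo] --> (0 : R).
  apply: cvg_frequently_small_0 => // [t|eps T e0]; first exact: sqdist_ge0.
  have /cvgrPdist_lt /(_ (eps / 2)) [|N _ hN] := cvg_series_cvg_0 cV; first by lra.
  have n1 : 0 < n%:R + 1 :> R by rewrite ltr_wpDl.
  have [t [Tt _ ct]] := xP (eps / 2 / (n%:R + 1)) (maxn T N)
    ltac:(by rewrite !divr_gt0).
  exists t; first exact: leq_trans (leq_maxl T N) Tt.
  have := hN t (leq_trans (leq_maxr T N) Tt); rewrite sub0r normrN => Vlt.
  have {}Vlt := le_lt_trans (ler_norm _) Vlt.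
  move: ct; rewrite ltr_pdivlMr // => ct; rewrite sqdist_V.
  by have := dot_ge0 (c t - x); rewrite -/(c t); lra.
rewrite -cvg_shiftS; apply: dot_dist_cvg0.
apply: (squeeze_cvgr _ (cvg_cst 0) dist0); apply: nearW => t.
by rewrite dot_ge0 dot_row_le_sqdist.
Qed.

End PathConvergence.

(** * Almost sure summability of the dispersion *)

Section SummabilityTools.
Context {R : realType}.

Lemma nneseries_le_partial (f : R ^nat) m (M : R) :
  (forall t, (m <= t)%N -> 0 <= f t) ->
  (\sum_(m <= t <oo) (f t)%:E <= M%:E)%E <->
  (forall N, \sum_(m <= t < N) f t <= M).
Proof.
move=> f0; have fE0 t : (m <= t)%N -> true -> (0 <= (f t)%:E)%E.
  by move=> mt _; rewrite lee_fin f0.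
split=> [le_M N|le_M].
  by rewrite -lee_fin -sumEFin; apply: le_trans (nneseries_lim_ge N fE0) le_M.
apply: lime_le; first exact: is_cvg_nneseries.
by apply: nearW => N; rewrite sumEFin lee_fin.
Qed.

(** Summing the recursion gives [S N.+1 <= u 0 + rho * S N + B] for the partial
    sums [S], and [S N <= S N.+1]. *)
Lemma contraction_series_ub (u b : R ^nat) (rho B : R) :
  (forall t, 0 <= u t) -> 0 <= rho < 1 ->
  (forall N, series b N <= B) ->
  (forall t, u t.+1 <= rho * u t + b t) ->
  forall N, series u N <= (u 0%N + B) / (1 - rho).
Proof.
move=> u0 /andP[rho0 rho1] bB step N.
rewrite ler_pdivlMr ?subr_gt0 //.
have : series u N.+1 <= u 0%N + (rho * series u N + series b N).
  rewrite /series /= big_nat_recl // lerD2l mulr_sumr -big_split /=.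
  by apply: ler_sum => t _; exact: step.
by rewrite seriesSr; have := bB N; have := u0 N; lra.
Qed.

End SummabilityTools.

Section Expectation.
Context {R : realType} {disp : measure_display} {Omega : measurableType disp}.
Variable P : probability Omega R.

Lemma history_setT n d (A : nat -> 'M[R]_(n, d) -> Omega -> 'M[R]_n)
    (X : nat -> Omega -> 'M[R]_(n, d)) t :
  history A X t [set: Omega].
Proof.
rewrite /history; set S := (X in <<s X >>).
have [s0 sC _] := smallest_sigma_algebra [set: Omega] S.
by have := sC _ s0; rewrite setD0.
Qed.

(** An almost sure bound on a conditional expectation bounds the expectation,
    by integrating over the whole space. Replacing [Y] by its positive
    part reduces this to comparing nonnegative functions almost everywhere. *)
Lemma cond_expectation_le (H : set (set Omega)) (Z Y c : Omega -> R) :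
  is_cond_expectation P H Z Y -> H [set: Omega] ->
  (forall omega, 0 <= c omega) -> P.-integrable [set: Omega] (EFin \o c) ->
  (\forall omega \ae P, Y omega <= c omega) ->
  (\int[P]_omega (Z omega)%:E <= \int[P]_omega (c omega)%:E)%E.
Proof.
move=> [_ iY _ YZ] HT c0 ic Yc; rewrite -(YZ _ HT).
have mY : measurable_fun [set: Omega] Y.
  by apply/measurable_EFinP; exact: measurable_int iY.
have mYp : measurable_fun [set: Omega] (fun omega => Num.max (Y omega) 0).
  exact: measurable_maxr.
apply: (@le_trans _ _ (\int[P]_omega (Num.max (Y omega) 0)%:E)%E).
  apply: le_integral => //.
    apply: le_integrable iY => //; first exact/measurable_EFinP.
    move=> omega _ /=; rewrite lee_fin ger0_norm ?le_max ?lexx ?orbT //.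
    by rewrite ge_max ler_norm normr_ge0.
  by move=> omega _; rewrite lee_fin le_max lexx.
apply: ae_ge0_le_integral => //.
- by move=> omega _; rewrite lee_fin le_max lexx orbT.
- exact/measurable_EFinP.
- by move=> omega _; rewrite lee_fin.
- exact: measurable_int ic.
- apply: filterS Yc => omega Yc _.
  by rewrite lee_fin ge_max Yc c0.
Qed.

(** By monotone convergence the sum of the series is integrable, hence finite
    almost everywhere. *)
Lemma ae_cvgn_series (g : nat -> Omega -> R) (S : R) :
  (forall t omega, 0 <= g t omega) ->
  (forall t, P.-integrable [set: Omega] (EFin \o g t)) ->
  (forall N, series (fun t => fine (\int[P]_omega (g t omega)%:E)) N <= S) ->
  \forall omega \ae P, cvgn (series (fun t => g t omega)).
Proof.
move=> g0 ig gS.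
have mg t : measurable_fun [set: Omega] (EFin \o g t).
  exact: measurable_int (ig t).
pose total omega := (\sum_(0 <= t <oo) (g t omega)%:E)%E.
have total0 omega : (0 <= total omega)%E.
  by apply: nneseries_ge0 => t _ _; rewrite lee_fin.
have mtotal : measurable_fun [set: Omega] total.
  apply: (@ge0_emeasurable_sum _ _ _ _ (fun t => EFin \o g t) predT) => //.
  by move=> t omega _ _; rewrite lee_fin.
have itotal : P.-integrable [set: Omega] total.
  apply/integrableP; split => //.
  under eq_integral do rewrite gee0_abs //.
  rewrite integral_nneseries //; last by move=> t omega _; rewrite lee_fin.
  have -> : (\sum_(0 <= t <oo) \int[P]_omega (g t omega)%:E =
      \sum_(0 <= t <oo) (fine (\int[P]_omega (g t omega)%:E))%:E)%E.
    apply: eq_eseriesr => t _; rewrite fineK //; exact: integrable_fin_num (ig t).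
  apply: (@le_lt_trans _ _ S%:E); last exact: ltry.
  apply/nneseries_le_partial => [t _|]; last exact: gS.
  by rewrite fine_ge0 // integral_ge0 // => omega _; rewrite lee_fin.
have := integrable_ae measurableT itotal.
apply: filterS => omega /(_ I) fin_total.
apply: (@nneg_series_ub_cvgn _ _ (fine (total omega))) => // N.
have := (nneseries_le_partial (m := 0) (fine (total omega)) (fun t _ => g0 t omega)).1.
by apply; rewrite fineK.
Qed.

(** Chaining the contraction by [lambda] with the growth by [1 + eps] of a
    subgradient step bounds the expected dispersion at one time by a fraction
    of the previous one, up to a summable error. *)
Lemma contracting_dispersion_summable n d
    (A : nat -> 'M[R]_(n, d) -> Omega -> 'M[R]_n)
    (X W G : nat -> Omega -> 'M[R]_(n, d)) (alpha : R ^nat)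
    (L : 'I_n -> R) (A2 : R) :
  (forall t omega, W t.+1 omega = at_state A X t omega *m X t omega) ->
  (forall t omega, X t.+1 omega = W t.+1 omega - alpha t.+1 *: G t.+1 omega) ->
  (forall t omega i, enorm (row i (G t.+1 omega)) <= L i) ->
  (forall N, series (fun t => alpha t.+1 ^+ 2) N <= A2) ->
  contracting P A X ->
  \forall omega \ae P, cvgn (series (fun t => V (W t.+1 omega))).
Proof.
move=> W_step X_step GL A2_ub.
have V0 (Z : 'M[R]_(n, d)) : 0 <= V Z by rewrite V_sqdist sqdist_ge0.
move=> [lambda /andP[l0 l1] contr].
pose g t omega := V (W t.+1 omega).
have gE t : g t = (fun omega => V (at_state A X t omega *m X t omega)).
  by apply/funext => omega; rewrite /g W_step.
have ig t : P.-integrable [set: Omega] (EFin \o g t).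
  by have [Y [iZ _ _ _] _] := contr t; rewrite gE.
pose u t := fine (\int[P]_omega (g t omega)%:E)%E.
have uE t : (\int[P]_omega (g t omega)%:E = (u t)%:E)%E.
  by rewrite /u fineK //; exact: integrable_fin_num (ig t).
(* With this [eps], the factor [lambda * (1 + eps)] is [1 - eps ^+ 2]. *)
pose eps := 1 - lambda.
have eps0 : 0 < eps by rewrite /eps; lra.
pose C := lambda * ((1 + eps^-1) * \sum_i L i ^+ 2).
have C0 : 0 <= C.
  rewrite !mulr_ge0 ?addr_ge0 ?invr_ge0 ?(ltW l0) ?(ltW eps0) //.
  by apply: sumr_ge0 => i _; exact: sqr_ge0.
have rho01 : 0 <= lambda * (1 + eps) < 1.
  by rewrite /eps; apply/andP; split; nra.
have ustep t : u t.+1 <= lambda * (1 + eps) * u t + C * alpha t.+1 ^+ 2.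
  rewrite -lee_fin -uE.
  have [Y YE Yle] := contr t.+1.
  have HT : history A X t.+1 [set: Omega] by exact: history_setT.
  rewrite gE.
  pose c omega := lambda * (1 + eps) * g t omega + C * alpha t.+1 ^+ 2.
  have ig' : P.-integrable [set: Omega]
      (fun omega => ((lambda * (1 + eps))%:E * (g t omega)%:E)%E).
    by apply: integrableZl => //; exact: ig.
  have ik : P.-integrable [set: Omega]
      (fun=> (C * alpha t.+1 ^+ 2)%:E).
    exact: finite_measure_integrable_cst.
  have cE : EFin \o c = (fun omega =>
      (lambda * (1 + eps))%:E * (g t omega)%:E + (C * alpha t.+1 ^+ 2)%:E)%E.
    by apply/funext => omega; rewrite /= /c EFinD EFinM.
  have ic : P.-integrable [set: Omega] (EFin \o c).
    by rewrite cE; exact: integrableD.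
  apply: (@le_trans _ _ (\int[P]_omega (c omega)%:E)%E).
    apply: (cond_expectation_le YE HT _ ic).
      have /andP[rho0 _] := rho01.
      by move=> omega; apply: addr_ge0; apply: mulr_ge0; rewrite ?sqr_ge0 ?V0.
    apply: filterS Yle => omega /le_trans; apply.
    rewrite /c /C -!mulrA -mulrDr ler_pM2l // mulrA X_step.
    by apply: V_subgradient_step => // i; exact: GL.
  rewrite (_ : (\int[P]_omega (c omega)%:E)%E =
    ((lambda * (1 + eps) * u t + C * alpha t.+1 ^+ 2))%:E) //.
  transitivity (\int[P]_omega ((EFin \o c) omega))%E => //.
  rewrite cE integralD // integralZl //; last exact: ig.
  rewrite uE integral_cst // [RHS]EFinD -[in RHS](mule1 (C * _)%:E).
  by congr (_ + _ * _)%E; exact: probability_setT.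
have b_ub N : series (fun t => C * alpha t.+1 ^+ 2) N <= C * A2.
  by rewrite /series /= -mulr_sumr; apply: (ler_wpM2l C0); exact: A2_ub.
have u0 t : 0 <= u t.
  by rewrite fine_ge0 // integral_ge0 // => omega _; rewrite lee_fin V0.
exact: (ae_cvgn_series (fun t omega => V0 _) ig
  (contraction_series_ub u0 rho01 b_ub ustep)).
Qed.

End Expectation.

(** * Almost sure convergence *)

Theorem theorem4 (R : realType) (disp : measure_display)
    (Omega : measurableType disp) (P : probability Omega R) (n d : nat)
    (f : 'I_n -> 'rV[R]_d -> R)
    (f_convex : forall i, convex_function [set: 'rV[R]_d] (f i))
    (F : 'rV[R]_d -> R)
    (F_def : forall w, F w = \sum_(i < n) f i w)
    (argmin_nonempty : argmin F !=set0)
    (bounded_subgradients : forall i, exists L : R,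
       forall w g, subdifferential (f i) w g -> enorm g <= L)
    (e : rel 'I_n) (e_connected : connected_graph e)
    (A : nat -> 'M[R]_(n, d) -> Omega -> 'M[R]_n)
    (X W G : nat -> Omega -> 'M[R]_(n, d))
    (alpha : nat -> R)
    (X_random : forall t, random_matrix (X t))
    (A_random : forall t, random_matrix (at_state A X t))
    (X0 : 'M[R]_(n, d))
    (X_init : forall omega, X 0%N omega = X0)
    (W_step : forall t omega,
       W t.+1 omega = at_state A X t omega *m X t omega)
    (G_subgradient : forall t omega i,
       subdifferential (f i) (row i (W t.+1 omega)) (row i (G t.+1 omega)))
    (X_step : forall t omega,
       X t.+1 omega = W t.+1 omega - alpha t.+1 *: G t.+1 omega)
    (A_doubly_stochastic : forall t,
       \forall omega \ae P, doubly_stochastic (at_state A X t omega))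
    (A_contracting : contracting P A X)
    (alpha_gt0 : forall t, (1 <= t)%N -> 0 < alpha t)
    (alpha_noninc : forall s t, (1 <= s <= t)%N -> alpha t <= alpha s)
    (alpha_sum : (\sum_(1 <= t <oo) (alpha t)%:E = +oo)%E)
    (alpha_sum2 : (\sum_(1 <= t <oo) (alpha t ^+ 2)%:E < +oo)%E) :
  \forall omega \ae P, exists2 w : 'rV[R]_d, argmin F w &
    forall i : 'I_n, (fun t => row i (W t omega)) @ \oo --> w.
Proof.
have [L fL] := choice bounded_subgradients.
have sq0 t : (1 <= t)%N -> 0 <= alpha t ^+ 2 by rewrite sqr_ge0.
pose A2 := fine (\sum_(1 <= t <oo) (alpha t ^+ 2)%:E)%E.
have A2_ub N : series (fun t => alpha t.+1 ^+ 2) N <= A2.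
  rewrite /series /= -(big_add1 _ _ _ N.+1 predT (fun t => alpha t ^+ 2)).
  apply: ((nneseries_le_partial A2 sq0).1 _ N.+1).
  rewrite /A2 fineK // ge0_fin_numE // nneseries_ge0 // => t t1 _.
  by rewrite lee_fin sq0.
have alpha_unbounded K : exists N, K < series (fun t => alpha t.+1) N.
  apply: contrapT => no.
  suff : (\sum_(1 <= t <oo) (alpha t)%:E <= K%:E)%E by rewrite alpha_sum.
  apply/nneseries_le_partial => [t t1|[|N]]; first exact/ltW/alpha_gt0.
    rewrite big_geq //; rewrite leNgt; apply/negP => K0; apply: no.
    by exists 0%N; rewrite /series /= big_geq.
  by rewrite big_add1 leNgt; apply/negP => KN; apply: no; exists N.
have alpha2_cvg : cvgn (series (fun t => alpha t.+1 ^+ 2)).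
  by apply: nneg_series_ub_cvgn A2_ub => t; rewrite sqr_ge0.
have GL t omega i : enorm (row i (G t.+1 omega)) <= L i.
  exact: fL (G_subgradient t omega i).
have V_summable := contracting_dispersion_summable W_step X_step GL A2_ub
  A_contracting.
have := ae_foralln A_doubly_stochastic.
apply: filterS2 V_summable => omega cV Ads.
apply: (@subgradient_path_cvg _ _ _ f F L (fun t => at_state A X t omega)
  (fun t => X t omega) (fun t => W t omega) (fun t => G t omega) alpha) => //.
by move=> t; exact: alpha_gt0.
Qed.
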